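(* Let $M$ be a left $\Lambda$-module (not necessarily finitely generated), identified with $P/C$, where $P$ is projective and $C\subseteq JP$. Then the canonical map $\phi:P/\varepsilon C\to P/C$ is a minimal right $\mathcal{P}^{<\infty}(\Lambda\text{-Mod})$-approximation of $M$. In particular, $\mathcal{P}^{<\infty}(\Lambda\text{-Mod})$ is contravariantly finite in $\Lambda\text{-Mod}$.
   Context: Let $K$ be a field, $Q$ a finite quiver with vertices $e_1,\dots,e_n$, $L\ge1$, and $\Lambda=KQ/I$ the truncated path algebra, $I$ generated by all paths of length $L+1$; $J$ is its Jacobson radical. A vertex $e_i$ is precyclic if some path (possibly of length $0$) starting at $e_i$ ends at a vertex on an oriented cycle of $Q$; $\varepsilon$ is the sum of the $e_i$ over non-precyclic vertices (so $\varepsilon C$ is a submodule for every submodule $C$). $\Lambda$-Mod is the category of all left $\Lambda$-modules and $\mathcal{P}^{<\infty}(\Lambda\text{-Mod})$ its full subcategory of modules of finite projective dimension. A right $\mathcal{C}$-approximation of $M$ is a morphism $\psi:B\to M$ with $B\in\mathcal{C}$ through which every morphism from an object of $\mathcal{C}$ to $M$ factors; it is minimal if every endomorphism $g$ of $B$ with $\psi g=\psi$ is an automorphism; $\mathcal{C}$ is contravariantly finite in $\Lambda$-Mod if every module has a right $\mathcal{C}$-approximation. *)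

(* Defs.v *)
From HB Require Import structures.
From mathcomp Require Import all_boot all_order all_algebra.
Set Implicit Arguments. Unset Strict Implicit. Unset Printing Implicit Defensive.
Import GRing.Theory.
Local Open Scope ring_scope.

(* A path is a pair (v, s): start vertex v and the list s of arrows in    *)
(* the order in which they are traversed.                                 *)
Section Quiver.
Variables (n : nat) (A : finType) (src tgt : A -> 'I_n).

Fixpoint walk (v : 'I_n) (s : seq A) : bool :=
  if s is a :: s' then (src a == v) && walk (tgt a) s' else true.

Definition endv (p : 'I_n * seq A) : 'I_n := last p.1 (map tgt p.2).

Definition qpath (L : nat) (p : 'I_n * seq A) : bool :=
  walk p.1 p.2 && (size p.2 <= L)%N.

Definition qedge : rel 'I_n := fun i j => [exists a, (src a == i) && (tgt a == j)].

Definition on_cycle (v : 'I_n) : bool :=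
  [exists a, (src a == v) && connect qedge (tgt a) v].

Definition precyclic (v : 'I_n) : bool :=
  [exists w, connect qedge v w && on_cycle w].
End Quiver.

(* Lambda = KQ/I, I generated by the paths of length L+1: a K-algebra     *)
(* with K-basis b indexed by the paths of length <= L, and product        *)
(* b p * b q = b (q followed by p) if composable and of length <= L,      *)
(* 0 otherwise (paths are composed right to left, e_end p e_start = p).   *)
Definition is_truncated_path_algebra (K : fieldType) (n : nat) (A : finType)
    (src tgt : A -> 'I_n) (L : nat) (Lam : algType K)
    (b : 'I_n * seq A -> Lam) : Prop :=
  [/\
      (forall x : Lam, exists (ps : seq ('I_n * seq A)) (c : 'I_n * seq A -> K),
          all (qpath src tgt L) ps /\ x = \sum_(p <- ps) c p *: b p),
      (forall (ps : seq ('I_n * seq A)) (c : 'I_n * seq A -> K),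
          uniq ps -> all (qpath src tgt L) ps ->
          \sum_(p <- ps) c p *: b p = 0 -> forall p, p \in ps -> c p = 0) &
      (forall p q, qpath src tgt L p -> qpath src tgt L q ->
          b p * b q = if (endv tgt q == p.1) && (size q.2 + size p.2 <= L)%N
                      then b (q.1, q.2 ++ p.2) else 0)].

Definition eps_np (K : fieldType) (n : nat) (A : finType) (src tgt : A -> 'I_n)
    (Lam : algType K) (b : 'I_n * seq A -> Lam) : Lam :=
  \sum_(i < n | ~~ precyclic src tgt i) b (i, [::]).

Section Modules.
Variable R : pzRingType.

Definition jacobson (x : R) : Prop := forall y : R, exists z : R, z * (1 - y * x) = 1.

Definition in_radP (P : lmodType R) (x : P) : Prop :=
  exists (m : nat) (j : 'I_m -> R) (p : 'I_m -> P),
    (forall i, jacobson (j i)) /\ x = \sum_(i < m) j i *: p i.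

Definition is_submodule (P : lmodType R) (C : P -> Prop) : Prop :=
  [/\ C 0, (forall x y, C x -> C y -> C (x + y)) & (forall a x, C x -> C (a *: x))].

Definition projective (P : lmodType R) : Prop :=
  forall (M N : lmodType R) (g : {linear M -> N}) (f : {linear P -> N}),
    (forall y, exists x, g x = y) ->
    exists h : {linear P -> M}, forall x, g (h x) = f x.

Fixpoint pd_le (k : nat) (M : lmodType R) : Prop :=
  match k with
  | 0 => projective M
  | k'.+1 => exists (P Kk : lmodType R) (f : {linear Kk -> P}) (g : {linear P -> M}),
      [/\ projective P, injective f, (forall y, exists x, g x = y),
          (forall x, g x = 0 <-> exists y, x = f y) & pd_le k' Kk]
  end.

Definition finite_pd (M : lmodType R) : Prop := exists k, pd_le k M.

Definition right_approx (Cat : lmodType R -> Prop) (B M : lmodType R)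
    (psi : {linear B -> M}) : Prop :=
  Cat B /\ forall (X : lmodType R) (f : {linear X -> M}), Cat X ->
    exists g : {linear X -> B}, forall x, psi (g x) = f x.

Definition minimal_right_approx (Cat : lmodType R -> Prop) (B M : lmodType R)
    (psi : {linear B -> M}) : Prop :=
  right_approx Cat psi /\
  forall g : {linear B -> B}, (forall x, psi (g x) = psi x) -> bijective g.

Definition contravariantly_finite (Cat : lmodType R -> Prop) : Prop :=
  forall M : lmodType R, exists (B : lmodType R) (psi : {linear B -> M}),
    right_approx Cat psi.
End Modules.

(* Main.v *)
Require Import Defs.
From HB Require Import structures.
From mathcomp Require Import all_boot all_order all_algebra.
From mathcomp Require Import generic_quotient ring_quotient boolp classical_sets.
Import GRing.Theory.
Local Open Scope ring_scope.
Set Implicit Arguments. Unset Strict Implicit. Unset Printing Implicit Defensive.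

(* Write eps for the sum of the non-precyclic idempotents. A module fixed by eps
   lives on an acyclic part of the quiver, so it has finite projective dimension;
   in particular eps C and hence P / eps C do.

   Every module X of finite projective dimension lifts along every surjection
   whose kernel Y is killed by eps. By induction on the dimension this amounts to
   extending maps from a syzygy E, embedded in a projective P, to such a Y. Modulo
   J Y such an extension is K-linear algebra, once E -> Y / J Y is known to vanish
   on the elements of E that lie in J P. These are killed by paths of length L
   starting at precyclic vertices, and such paths detect the top of a module that
   has the lifting property. Nilpotency of J then removes the error in J Y.
   Applied to P / eps C -> P / C, whose kernel C / eps C is killed by eps, the
   lifting property gives the approximation. It is minimal because an
   endomorphism over P / C differs from the identity by a map into J (P / eps C). *)

(** * Linear relations, submodules and quotients *)

Section LinearRelations.
Variables (R : pzRingType) (V W : lmodType R).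

(** Graphs of partial, possibly multivalued, linear maps. Maps are built below by describing their
    graphs. *)
Definition linear_relation (G : V -> W -> Prop) : Prop :=
  G 0 0 /\
  forall a x y x' y', G x y -> G x' y' -> G (a *: x + x') (a *: y + y').

(** For a linear relation, a single value at 0 means a single value everywhere, by subtraction. *)
Definition functional_relation (G : V -> W -> Prop) : Prop :=
  forall y, G 0 y -> y = 0.

Lemma linear_of_relation (G : V -> W -> Prop) :
  linear_relation G -> functional_relation G -> (forall x, exists y, G x y) ->
  exists f : {linear V -> W}, forall x y, G x y -> f x = y.
Proof.
move=> [G0 Glin] Gfun Gtot.
have Guniq x y y' : G x y -> G x y' -> y = y'.
  move=> Gy Gy'; have := Glin (-1) _ _ _ _ Gy' Gy.
  by rewrite !scaleN1r addNr addrC => /Gfun /subr0_eq.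
have [f fG] := choice Gtot.
have f_lin : linear f.
  by move=> a x y; apply: (Guniq (a *: x + y)); [exact: fG | exact: Glin].
pose fL := GRing.isLinear.Build R V W _ f f_lin.
pose F : {linear V -> W} := HB.pack f fL.
by exists F => x y Gxy; apply: Guniq Gxy; exact: fG.
Qed.
End LinearRelations.

Lemma factor_through_surjective (R : pzRingType) (V W U : lmodType R)
    (p : {linear V -> W}) (f : {linear V -> U}) :
  (forall y, exists x, p x = y) -> (forall x, p x = 0 -> f x = 0) ->
  exists h : {linear W -> U}, forall x, h (p x) = f x.
Proof.
move=> p_surj ker_pf.
pose G y u := exists2 x, p x = y & f x = u.
have [||y|h hG] := @linear_of_relation R W U G.
- split; first by exists 0; rewrite linear0.
  by move=> a _ _ _ _ [x <- <-] [x' <- <-]; exists (a *: x + x'); rewrite linearP.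
- by move=> _ [x /ker_pf + <-].
- by have [x <-] := p_surj y; exists (f x); exists x.
- by exists h => x; apply: hG; exists x.
Qed.

Lemma factor_through_injective (R : pzRingType) (V W U : lmodType R)
    (i : {linear V -> W}) (f : {linear U -> W}) :
  injective i -> (forall x, exists y, f x = i y) ->
  exists h : {linear U -> V}, forall x, i (h x) = f x.
Proof.
move=> i_inj f_im.
have [||//|h hG] := @linear_of_relation R U V (fun x y => f x = i y).
- split; first by rewrite !linear0.
  by move=> a x y x' y' e e'; rewrite !linearP e e'.
- by move=> y; rewrite linear0 -(linear0 i) => /i_inj.
- by exists h => x; have [y fx] := f_im x; rewrite (hG _ _ fx).
Qed.

Lemma kernel_submodule (R : pzRingType) (V W : lmodType R) (f : {linear V -> W}) :
  is_submodule (fun x => f x = 0).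
Proof.
split; first exact: linear0.
  by move=> x y fx fy; rewrite linearD fx fy addr0.
by move=> a x fx; rewrite linearZ_LR fx scaler0.
Qed.

Section SubQuotient.
Variables (R : pzRingType) (V : lmodType R) (S : V -> Prop).
Hypothesis S_sub : is_submodule S.

Definition submod_pred : {pred V} := fun x => `[< S x >].

Lemma submod_predE x : x \in submod_pred <-> S x.
Proof. by split => /asboolP. Qed.

Let submod_pred_closed : submod_closed submod_pred.
Proof.
have [S0 SD SZ] := S_sub.
split; first exact/submod_predE.
by move=> a x y /submod_predE Sx /submod_predE Sy; apply/submod_predE/SD; [exact: SZ|].
Qed.

HB.instance Definition _ :=
  GRing.isSubmodClosed.Build R V submod_pred submod_pred_closed.

Record submod := Submod { submod_val : V; submod_valP : submod_val \in submod_pred }.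
HB.instance Definition _ := [isSub for submod_val].
HB.instance Definition _ := [Choice of submod by <:].
HB.instance Definition _ := [SubChoice_isSubLmodule of submod by <:].

Lemma submodule_exists : exists (N : lmodType R) (i : {linear N -> V}),
  injective i /\ forall x, S x <-> exists y, x = i y.
Proof.
exists submod, (val : {linear submod -> V}); split; first exact: val_inj.
move=> x; split=> [/submod_predE Sx | [y ->]]; first by exists (Submod Sx).
exact/submod_predE/valP.
Qed.

Local Open Scope quotient_scope.

Definition quotmod : Type := (Quotient.quot submod_pred).
HB.instance Definition _ := GRing.Zmodule.on quotmod.

Definition quotmod_pi (x : V) : quotmod := \pi_(Quotient.quot submod_pred) x.

Let quotmod_eq x y : quotmod_pi x = quotmod_pi y <-> S (x - y).
Proof.
rewrite /quotmod_pi; split => [/eqP|Sxy]; last apply/eqP.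
  by rewrite -Quotient.idealrBE => /submod_predE.
by rewrite -Quotient.idealrBE; apply/submod_predE.
Qed.

Let quotmod_piD x y : quotmod_pi (x + y) = quotmod_pi x + quotmod_pi y.
Proof. exact: (raddfD (\pi_(Quotient.quot submod_pred))). Qed.

Definition quotmod_scale (a : R) (u : quotmod) : quotmod :=
  quotmod_pi (a *: repr (u : (Quotient.quot submod_pred))).

Let quotmod_surj u : exists x, quotmod_pi x = u.
Proof. by exists (repr (u : (Quotient.quot submod_pred))); rewrite /quotmod_pi reprK. Qed.

Let quotmod_scaleE a x : quotmod_scale a (quotmod_pi x) = quotmod_pi (a *: x).
Proof.
apply/quotmod_eq; rewrite -scalerBr; have [_ _ SZ] := S_sub; apply: SZ.
by apply/quotmod_eq; rewrite /quotmod_pi reprK.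
Qed.

Let quotmod_scalerA a c u :
  quotmod_scale a (quotmod_scale c u) = quotmod_scale (a * c) u.
Proof. by have [x <-] := quotmod_surj u; rewrite !quotmod_scaleE scalerA. Qed.

Let quotmod_scale1r : left_id 1 quotmod_scale.
Proof. by move=> u; have [x <-] := quotmod_surj u; rewrite quotmod_scaleE scale1r. Qed.

Let quotmod_scalerDr : right_distributive quotmod_scale +%R.
Proof.
move=> a u v; have [x <-] := quotmod_surj u; have [y <-] := quotmod_surj v.
by rewrite -quotmod_piD !quotmod_scaleE scalerDr quotmod_piD.
Qed.

Let quotmod_scalerDl u : {morph quotmod_scale^~ u : a c / a + c}.
Proof.
by move=> a c; have [x <-] := quotmod_surj u; rewrite !quotmod_scaleE scalerDl quotmod_piD.
Qed.

HB.instance Definition _ := GRing.Zmodule_isLmodule.Build R quotmod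
  quotmod_scalerA quotmod_scale1r quotmod_scalerDr quotmod_scalerDl.

Let quotmod_pi_linear : linear quotmod_pi.
Proof. by move=> a x y; rewrite quotmod_piD -quotmod_scaleE. Qed.

HB.instance Definition _ := GRing.isLinear.Build R V quotmod _ quotmod_pi quotmod_pi_linear.

Lemma quotient_exists : exists (Q : lmodType R) (p : {linear V -> Q}),
  (forall y, exists x, p x = y) /\ forall x, p x = 0 <-> S x.
Proof.
exists quotmod, quotmod_pi; split => // x.
by rewrite -(linear0 quotmod_pi) -{2}(subr0 x); apply: quotmod_eq.
Qed.
End SubQuotient.

(** * Extension of linear maps over a field *)

Section LinearExtension.
Variables (K : fieldType) (V W : lmodType K).
Local Open Scope classical_set_scope.

(** Zorn's lemma for sets of pairs adjoined to [G0]: a maximal one is defined everywhere, since a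
    missing vector could be sent to 0. *)
Lemma linear_relation_extends (G0 : V -> W -> Prop) :
  linear_relation G0 -> functional_relation G0 ->
  exists f : {linear V -> W}, forall x y, G0 x y -> f x = y.
Proof.
move=> G0_lin G0_fun.
(* Joining [G0] to [X] makes the union of the empty chain admissible. *)
pose gr (X : set (V * W)) x y := G0 x y \/ X (x, y).
pose good X := linear_relation (gr X) /\ functional_relation (gr X).
have [F F_good F_tot|X [[[X0 X_lin] X_fun] X_max]] := @Zorn_bigcup (V * W)%type good.
  have common x y x' y' : gr (\bigcup_(X in F) X) x y -> gr (\bigcup_(X in F) X) x' y' ->
      (G0 x y /\ G0 x' y') \/ exists X, [/\ F X, gr X x y & gr X x' y'].
    move=> [Gxy|[X FX Xxy]] [Gxy'|[X' FX' Xxy']]; first by left.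
    - by right; exists X'; split=> //; [left|right].
    - by right; exists X; split=> //; [right|left].
    - by case: (F_tot _ _ FX FX') => XX'; right; [exists X'|exists X];
        split=> //; right=> //; apply: XX'.
  have toU X x y : F X -> gr X x y -> gr (\bigcup_(X in F) X) x y.
    by move=> FX [Gxy|Xxy]; [left|right; exists X].
  split; first split; first by left; case: G0_lin.
    move=> a x y x' y' xy xy'; case: (common _ _ _ _ xy xy') => [[Gxy Gxy']|[X [FX Xxy Xxy']]].
      by left; apply: G0_lin.2.
    by have [[_ lin] _] := F_good _ FX; apply: toU FX _; apply: lin.
  move=> y y0; case: (common _ _ _ _ y0 y0) => [[Gy _]|[X [FX Xy _]]]; first exact: G0_fun.
  by have [_ fn] := F_good _ FX; apply: fn.
have X_tot x : exists y, gr X x y.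
  apply: contrapT => x_out.
  have grZ a u w : gr X u w -> gr X (a *: u) (a *: w).
    by move=> uw; have := X_lin a _ _ _ _ uw X0; rewrite !addr0.
  pose Y := [set z : V * W | exists k u, gr X u z.2 /\ z.1 = u + k *: x].
  have grY u w : gr Y u w -> Y (u, w).
    by move=> [Guw|//]; exists 0, u; rewrite scale0r addr0; split=> //; left.
  apply: (X_max Y); last first.
    split; first split; first by left; case: G0_lin.
      move=> a u w u' w' /grY[/= k [v [vw ->]]] /grY[/= k' [v' [vw' ->]]].
      right; exists (a * k + k'), (a *: v + v'); split; first exact: X_lin.
      by rewrite /= scalerDr scalerDl scalerA addrACA.
    move=> w /grY[/= k [v [vw /esym/eqP]]]; rewrite addr_eq0 => /eqP v_eq.
    have [k0|k_neq0] := eqVneq k 0.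
      by apply: X_fun; move: vw; rewrite v_eq k0 scale0r oppr0.
    (* With [k] nonzero, [x] would already have a value. *)
    case: x_out; exists (- k^-1 *: w).
    by have := grZ (- k^-1) _ _ vw; rewrite v_eq scaleNr scalerN opprK scalerA mulVf // scale1r.
  split=> [[u w] Xuw|YX]; first by apply: grY; right; exists 0, u; rewrite scale0r addr0; split=> //; right.
  apply: x_out; exists 0; right; apply: YX; exists 1, 0; split; first exact: X0.
  by rewrite /= add0r scale1r.
have [f fX] := linear_of_relation (conj X0 X_lin) X_fun X_tot.
by exists f => x y Gxy; apply: fX; left.
Qed.
End LinearExtension.

(** * Walks and precyclic vertices *)

Section Walks.
Variables (n : nat) (A : finType) (src tgt : A -> 'I_n).
Local Notation walk := (walk src tgt).
Local Notation precyclic := (precyclic src tgt).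
Local Notation edge := (qedge src tgt).

Lemma walk_cat v s s' : walk v (s ++ s') = walk v s && walk (endv tgt (v, s)) s'.
Proof. by elim: s v => [|c s IHs] v //=; rewrite IHs andbA. Qed.

Lemma walk_rcons v s a :
  walk v (rcons s a) = walk v s && (src a == endv tgt (v, s)).
Proof. by rewrite -cats1 walk_cat /= andbT. Qed.

Lemma walk_connect v s : walk v s -> connect edge v (endv tgt (v, s)).
Proof.
elim: s v => [|c s IHs] v /=; first by rewrite /endv connect0.
case/andP=> /eqP <- /IHs; apply: connect_trans.
by apply: connect1; apply/existsP; exists c; rewrite !eqxx.
Qed.

Lemma walk_precyclic v s : walk v s -> precyclic (endv tgt (v, s)) -> precyclic v.
Proof.
move=> /walk_connect vw /existsP[w /andP[ww cyc]].
by apply/existsP; exists w; rewrite cyc (connect_trans vw ww).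
Qed.

Lemma precyclic_step v : precyclic v -> exists2 a, src a = v & precyclic (tgt a).
Proof.
case/existsP=> w /andP[/connectP[[|u p] /= + ->] cyc].
  move=> _; have /existsP[a /andP[/eqP sa aw]] := cyc; exists a => //.
  by apply/existsP; exists v; rewrite aw.
case/andP=> /existsP[a /andP[/eqP sa /eqP ta]] up; exists a => //; rewrite ta.
by apply/existsP; exists (last u p); rewrite cyc andbT; apply/connectP; exists p.
Qed.

(** Every precyclic vertex has an arrow to a precyclic vertex, so walks can be prolonged at will. *)
Lemma precyclic_walk k v : precyclic v ->
  exists s, [/\ walk v s, size s = k & precyclic (endv tgt (v, s))].
Proof.
elim: k v => [|k IHk] v pv; first by exists [::].
have [a sa /IHk[s [ws <- ps]]] := precyclic_step pv.
by exists (a :: s); rewrite /= sa eqxx.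
Qed.

(** A rank for induction, which will bound projective dimensions. *)
Definition reach (v : 'I_n) : nat := #|[pred w | connect edge v w]|.

Lemma reach_gt0 v : (0 < reach v)%N.
Proof. by apply/card_gt0P; exists v; rewrite inE connect0. Qed.

Lemma reach_le v : (reach v <= n)%N.
Proof. by rewrite -[leqRHS]card_ord max_card. Qed.

(** The endpoint reaches only what [v] reaches, but not [v] itself: that would close a cycle through
    [v]. *)
Lemma reach_walk v a s : ~~ precyclic v -> walk v (a :: s) ->
  (reach (endv tgt (v, a :: s)) < reach v)%N.
Proof.
move=> npv ws; have vw := walk_connect ws; apply: proper_card.
apply/properP; split.
  by apply/fintype.subsetP => u; rewrite !inE; apply: connect_trans.
exists v; rewrite !inE ?connect0 //; apply: contra npv => wv.
case/andP: ws => /eqP sa /walk_connect tw.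
apply/existsP; exists v; rewrite connect0; apply/existsP; exists a.
by rewrite sa eqxx /=; apply: connect_trans wv.
Qed.
End Walks.

(** * Restriction of scalars to K *)

Section RestrictionOfScalars.
Variables (K : fieldType) (Lam : algType K).

(** An alias, so that the same group can carry the K-module structure beside the one over [Lam]. *)
Definition restrict (N : lmodType Lam) : Type := N.
HB.instance Definition _ N := GRing.Zmodule.on (restrict N).

Section Scale.
Variable N : lmodType Lam.
Definition restrict_scale (k : K) (x : restrict N) : restrict N := k%:A *: (x : N).

Let restrict_scalerA k k' x :
  restrict_scale k (restrict_scale k' x) = restrict_scale (k * k') x.
Proof. by rewrite /restrict_scale scalerA mulr_algl scalerA. Qed.

Let restrict_scale1r : left_id 1 restrict_scale.
Proof. by move=> x; rewrite /restrict_scale !scale1r. Qed.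

Let restrict_scalerDr : right_distributive restrict_scale +%R.
Proof. by move=> k x y; apply: scalerDr. Qed.

Let restrict_scalerDl x : {morph restrict_scale^~ x : k k' / k + k'}.
Proof. by move=> k k'; rewrite /restrict_scale !scalerDl. Qed.

HB.instance Definition _ := GRing.Zmodule_isLmodule.Build K (restrict N)
  restrict_scalerA restrict_scale1r restrict_scalerDr restrict_scalerDl.
End Scale.

Lemma alg_scalerC (N : lmodType Lam) k a (x : N) : a *: (k%:A *: x) = k%:A *: (a *: x).
Proof. by rewrite !scalerA mulr_algl mulr_algr. Qed.

Lemma alg_scalerAl (N : lmodType Lam) k a (x : N) : (k *: a) *: x = k%:A *: (a *: x).
Proof. by rewrite !scalerA mulr_algl. Qed.

Lemma alg_scaler_suml (N : lmodType Lam) (I : finType) (P : pred I) (c : I -> K) (x : N) :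
  (\sum_(i | P i) c i)%:A *: x = \sum_(i | P i) (c i)%:A *: x.
Proof. by rewrite !scaler_suml. Qed.

(** Over K the inclusion [i] of the kernel has a retraction [r]; then [x - i (r x)] depends only on
    [g x]. *)
Lemma surjective_section (M N : lmodType Lam) (g : {linear M -> N}) :
  (forall y, exists x, g x = y) ->
  exists s : {linear restrict N -> restrict M}, forall y, g (s y) = y.
Proof.
move=> g_surj.
have [N0 [i [i_inj im_i]]] := submodule_exists (kernel_submodule g).
have gi y : g (i y) = 0 by apply/im_i; exists y.
have [||r rG] := @linear_relation_extends K (restrict M) (restrict N0) (fun x y => x = i y).
- split; first by rewrite linear0.
  by move=> k x y x' y' -> ->; rewrite /= [RHS](linearP i).
- by move=> y; rewrite -(linear0 i) => /i_inj.
pose G (z : restrict N) (w : restrict M) := exists x : M, g x = z /\ w = x - i (r x).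
have [||z|s sG] := @linear_of_relation K _ _ G.
- split; first by exists 0; split; rewrite ?(rG 0 0) linear0 ?subr0.
  move=> k _ _ _ _ [x [<- ->]] [x' [<- ->]]; exists (k%:A *: x + x').
  split; first by rewrite linearP.
  have -> : r (k%:A *: x + x') = k%:A *: (r x : N0) + r x' :> N0 by exact: (linearP r).
  by rewrite linearP opprD addrACA -scalerBr.
- by move=> _ [x [/im_i[y ->] ->]]; rewrite (rG _ y) ?subrr.
- by have [x gx] := g_surj z; exists (x - i (r x)), x.
exists s => y; have [x gx] := g_surj y.
by rewrite (sG y (x - i (r x))); [rewrite linearB gi subr0 | exists x].
Qed.
End RestrictionOfScalars.

Lemma projective_retract (R : pzRingType) (P Q : lmodType R)
    (i : {linear Q -> P}) (r : {linear P -> Q}) :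
  cancel i r -> projective P -> projective Q.
Proof.
move=> ri P_proj M N g f g_surj.
have [h gh] := P_proj M N g (f \o r) g_surj.
by exists (h \o i) => x; rewrite /= gh /= ri.
Qed.

(** * Truncated path algebras *)

Section TruncatedPathAlgebra.
Variables (K : fieldType) (n : nat) (A : finType) (src tgt : A -> 'I_n) (L : nat).
Hypothesis HL : (1 <= L)%N.
Variables (Lam : algType K) (b : 'I_n * seq A -> Lam).
Hypothesis HLam : is_truncated_path_algebra src tgt L b.

Local Notation precyclic := (precyclic src tgt).
Local Notation endv := (endv tgt).
Local Notation qpath := (qpath src tgt L).
Local Notation e i := (b (i, [::])).
Local Notation ar a := (b (src a, [:: a])).
Local Notation eps := (eps_np src tgt b).

(** * The finite path basis and its coordinates *)

Definition tpath : Type := {p : 'I_n * L.-bseq A | walk src tgt p.1 p.2}.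
HB.instance Definition _ := Finite.on tpath.

Definition pth (p : tpath) : 'I_n * seq A := ((val p).1, (val p).2 : seq A).

Lemma pth_qpath p : qpath (pth p).
Proof. by rewrite /Defs.qpath (valP p) size_bseq. Qed.

Lemma pth_inj : injective pth.
Proof.
move=> [[v s] ws] [[v' s'] ws'] [/= vv ss].
by apply: val_inj => /=; congr (_, _) => //; apply: val_inj.
Qed.

Lemma pth_surj p : qpath p -> exists p', pth p' = p.
Proof.
case: p => v s /andP[ws sL].
by exists (exist _ (v, Bseq sL) ws : tpath).
Qed.

Lemma qpath_e i : qpath (i, [::]). Proof. by []. Qed.

Lemma qpath_ar a : qpath (src a, [:: a]).
Proof. by rewrite /Defs.qpath /= eqxx HL. Qed.
#[local] Hint Resolve pth_qpath qpath_e qpath_ar : core.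

Lemma expansion_exists x : exists c : tpath -> K, x = \sum_p c p *: b (pth p).
Proof.
have [/(_ x) [ps [c [ps_q ->]]] _ _] := HLam.
elim: ps ps_q => [|p ps IHps] /=.
  by exists (fun=> 0); rewrite big_nil big1 // => p _; rewrite scale0r.
case/andP=> /pth_surj[q <-] /IHps[d dE].
(* A path may be repeated in [ps], so coefficients accumulate. *)
exists (fun r => d r + c (pth q) *+ (r == q)); rewrite big_cons dE addrC.
rewrite -[in RHS](big_mkcond xpredT) /=.
under [RHS]eq_bigr do rewrite scalerDl.
rewrite big_split /=; congr (_ + _); rewrite (bigD1 q) //= eqxx big1 ?addr0 // => r.
by move/negPf=> ->; rewrite mulr0n scale0r.
Qed.

Definition co (p : tpath) (x : Lam) : K := projT1 (cid (expansion_exists x)) p.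

Lemma coE x : x = \sum_p co p x *: b (pth p).
Proof. exact: (projT2 (cid (expansion_exists x))). Qed.

Lemma b_free (c : tpath -> K) : \sum_p c p *: b (pth p) = 0 -> forall p, c p = 0.
Proof.
move=> c0 p; have [_ free _] := HLam.
(* [d] carries the coefficients over to arbitrary pairs, with default 0. *)
pose d q := oapp c 0 [pick p' | pth p' == q].
have dE p' : d (pth p') = c p'.
  by rewrite /d; case: pickP => [r /eqP/pth_inj -> //|/(_ p')]; rewrite eqxx.
rewrite -dE; apply: (free [seq pth q | q <- enum {: tpath}]).
- by rewrite map_inj_uniq ?enum_uniq //; exact: pth_inj.
- by apply/allP => _ /mapP[q _ ->].
- by rewrite big_map big_enum /=; under eq_bigr do rewrite dE.
- by apply: map_f; rewrite mem_enum.
Qed.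

Lemma co_sum (c : tpath -> K) p : co p (\sum_q c q *: b (pth q)) = c p.
Proof.
apply/eqP; rewrite -subr_eq0; apply/eqP.
apply: (b_free (c := fun q => co q (\sum_q c q *: b (pth q)) - c q)).
under eq_bigr do rewrite scalerBl.
by rewrite sumrB -coE subrr.
Qed.

Let co_linear p : linear (co p : Lam -> K^o).
Proof.
move=> k x y; rewrite {1}[x]coE {1}[y]coE scaler_sumr -big_split /=.
under eq_bigr do rewrite scalerA -scalerDl.
exact: co_sum.
Qed.

HB.instance Definition _ p := GRing.isLinear.Build K Lam K^o _ (co p) (co_linear p).

Lemma coZ p k x : co p (k *: x) = k * co p x.
Proof. exact: (linearZ_LR (co p : {linear Lam -> K^o})). Qed.

Lemma co_sumr p (I : finType) (F : I -> Lam) : co p (\sum_i F i) = \sum_i co p (F i).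
Proof. exact: (linear_sum (co p : {linear Lam -> K^o})). Qed.

Lemma co_b p q : co q (b (pth p)) = (p == q)%:R.
Proof.
rewrite -(co_sum (fun q => (p == q)%:R)); congr (co q _).
rewrite (bigD1 p) //= eqxx scale1r big1 ?addr0 // => r.
by rewrite eq_sym => /negPf ->; rewrite scale0r.
Qed.

Lemma co_b_neq p q : qpath p -> p != pth q -> co q (b p) = 0.
Proof.
by case/pth_surj=> p' <-; rewrite co_b; case: (p' =P q) => // ->; rewrite eqxx.
Qed.

Lemma b_mul p q : qpath p -> qpath q -> b p * b q =
  if (endv q == p.1) && (size q.2 + size p.2 <= L)%N then b (q.1, q.2 ++ p.2) else 0.
Proof. by have [_ _] := HLam; apply. Qed.

Lemma e_mul_b i q : qpath q -> e i * b q = if endv q == i then b q else 0.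
Proof.
move=> q_q; rewrite b_mul //= addn0 cats0 -surjective_pairing.
by case/andP: q_q => _ ->; rewrite andbT.
Qed.

Lemma b_mul_e p i : qpath p -> b p * e i = if i == p.1 then b p else 0.
Proof.
move=> p_q; rewrite b_mul // -[endv _]/i /= add0n; case/andP: p_q => _ ->; rewrite andbT.
by case: (i =P _) => // ->; rewrite -surjective_pairing.
Qed.

Lemma ar_mul_b a q : qpath q -> ar a * b q =
  if (endv q == src a) && (size q.2 < L)%N then b (q.1, rcons q.2 a) else 0.
Proof. by move=> q_q; rewrite b_mul //= addn1 cats1. Qed.

Lemma e_mul_e i j : e i * e j = if i == j then e i else 0.
Proof. by rewrite e_mul_b // -[endv _]/j eq_sym; case: (i =P j) => // ->. Qed.

Lemma b_rcons v s a : qpath (v, rcons s a) -> b (v, rcons s a) = ar a * b (v, s).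
Proof.
rewrite /Defs.qpath /= walk_rcons size_rcons => /andP[/andP[ws /eqP sa] sL].
by rewrite ar_mul_b ?sa ?eqxx /= ?sL // /Defs.qpath /= ws ltnW.
Qed.

Lemma qpath_rconsW v s a : qpath (v, rcons s a) -> qpath (v, s).
Proof.
by rewrite /Defs.qpath /= walk_rcons size_rcons => /andP[/andP[-> _]] /ltnW ->.
Qed.

Lemma sum_e : \sum_i e i = 1.
Proof.
suff u1 x : (\sum_i e i) * x = x by rewrite -[LHS]mulr1 u1.
rewrite [x]coE mulr_sumr; apply: eq_bigr => p _; rewrite -scalerAr; congr (_ *: _).
rewrite mulr_suml (bigD1 (endv (pth p))) //= e_mul_b // eqxx big1 ?addr0 // => i ip.
by rewrite e_mul_b // eq_sym (negPf ip).
Qed.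

Lemma e_decomposition (N : lmodType Lam) (x : N) : x = \sum_i e i *: x.
Proof. by rewrite -scaler_suml sum_e scale1r. Qed.

(** Vertices and arrows generate [Lam]: a path is the product of its arrows and its starting
    vertex. *)
Lemma Lam_ind (Q : Lam -> Prop) :
  (forall i, Q (e i)) -> (forall a, Q (ar a)) -> Q 0 ->
  (forall k x, Q x -> Q (k *: x)) -> (forall x y, Q x -> Q y -> Q (x + y)) ->
  (forall x y, Q x -> Q y -> Q (x * y)) -> forall x, Q x.
Proof.
move=> Qe Qar Q0 QZ QD QM x; rewrite [x]coE; apply: (big_ind Q) => // p _; apply: QZ.
case: (pth p) (pth_qpath p) => v s; elim/last_ind: s => [|s a IHs] // p_q.
by rewrite b_rcons //; apply: QM => //; apply: IHs; apply: qpath_rconsW p_q.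
Qed.

(** * Powers of the radical *)

(* [rad m x] says that [x] lies in [J^m N]: as a right ideal, [J] is generated by
   the arrows. *)
Fixpoint rad (N : lmodType Lam) (m : nat) (x : N) : Prop :=
  if m is m'.+1 then
    exists y : A -> N, (forall a, rad m' (y a)) /\ x = \sum_a ar a *: y a
  else True.

Lemma rad0 (N : lmodType Lam) m : rad m (0 : N).
Proof.
elim: m => //= m IHm; exists (fun=> 0); split=> //.
by rewrite big1 // => a _; rewrite scaler0.
Qed.

Lemma radD (N : lmodType Lam) m (x y : N) : rad m x -> rad m y -> rad m (x + y).
Proof.
elim: m x y => //= m IHm _ _ [x [rx ->]] [y [ry ->]].
exists (fun a => x a + y a); split; first by move=> a; apply: IHm.
by rewrite -big_split; apply: eq_bigr => a _; rewrite scalerDr.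
Qed.

Lemma rad_alg (N : lmodType Lam) m k (x : N) : rad m x -> rad m (k%:A *: x).
Proof.
elim: m x => //= m IHm _ [x [rx ->]].
exists (fun a => k%:A *: x a); split; first by move=> a; apply: IHm.
by rewrite scaler_sumr; apply: eq_bigr => a _; rewrite alg_scalerC.
Qed.

Lemma radW (N : lmodType Lam) m (x : N) : rad m.+1 x -> rad m x.
Proof.
elim: m x => // m IHm x [y [ry ->]].
by exists y; split=> // a; apply: IHm; apply: ry.
Qed.

Lemma rad_ar (N : lmodType Lam) m a (x : N) : rad m x -> rad m.+1 (ar a *: x).
Proof.
move=> rx; exists (fun c => if c == a then x else 0); split.
  by move=> c; case: ifP => // _; apply: rad0.
rewrite (bigD1 a) //= eqxx big1 ?addr0 // => c /negPf ->.
by rewrite scaler0.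
Qed.

(** Induction over generators: a vertex selects the arrows that end there, and an arrow sends
    [J^m N] into [J^(m+1) N]. *)
Lemma rad_scale (N : lmodType Lam) m c (x : N) : rad m x -> rad m (c *: x).
Proof.
case: m => // m; move: c x; apply: Lam_ind => [i|a||k c IHc|c d IHc IHd|c d IHc IHd] x rx.
- have [y [ry ->]] := rx.
  exists (fun a => if tgt a == i then y a else 0); split.
    by move=> a; case: ifP => _; [exact: ry | exact: rad0].
  rewrite scaler_sumr; apply: eq_bigr => a _.
  rewrite scalerA e_mul_b // /Defs.endv /=; case: ifP => // _.
  by rewrite scale0r scaler0.
- by apply: rad_ar; apply: radW.
- by rewrite scale0r; apply: rad0.
- by rewrite alg_scalerAl; apply: rad_alg; apply: IHc.
- by rewrite scalerDl; apply: radD; [apply: IHc | apply: IHd].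
- by rewrite -scalerA; apply/IHc/IHd.
Qed.

Lemma radN (N : lmodType Lam) m (x : N) : rad m x -> rad m (- x).
Proof. by move=> rx; rewrite -scaleN1r; apply: rad_scale. Qed.

Lemma rad_submodule (N : lmodType Lam) m : is_submodule (@rad N m).
Proof. by split; [exact: rad0 | exact: radD | exact: rad_scale]. Qed.

Lemma rad_linear (M N : lmodType Lam) (f : {linear M -> N}) m x : rad m x -> rad m (f x).
Proof.
elim: m x => //= m IHm _ [x [rx ->]].
exists (f \o x); split; first by move=> a; apply: IHm.
by rewrite linear_sum; apply: eq_bigr => a _; rewrite linearZ.
Qed.

Lemma rad_linear_shift (M N : lmodType Lam) (f : {linear M -> N}) k m x :
  (forall x, rad k (f x)) -> rad m x -> rad (m + k) (f x).
Proof.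
move=> rf; elim: m x => //= m IHm _ [x [rx ->]].
exists (f \o x); split; first by move=> a; apply: IHm.
by rewrite linear_sum; apply: eq_bigr => a _; rewrite linearZ.
Qed.

(** Each arrow split off from [x] is absorbed into [p], until the path becomes too long. *)
Lemma b_rad (N : lmodType Lam) m (x : N) p :
  rad m x -> qpath p -> (L < size p.2 + m)%N -> b p *: x = 0.
Proof.
elim: m x p => [|m IHm] x p.
  by move=> _ /andP[_ pL]; rewrite addn0 ltnNge pL.
case=> y [ry ->] p_q pL; rewrite scaler_sumr big1 // => a _; rewrite scalerA.
rewrite b_mul //=; case: ifP => [/andP[/eqP pa sL]|_]; last by rewrite scale0r.
apply: IHm; [exact: ry | | by rewrite /= addSn -addnS].
by move: sL p_q; rewrite /Defs.qpath /= -pa eqxx => -> /andP[-> _].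
Qed.

Lemma rad_nilpotent (N : lmodType Lam) (x : N) : rad L.+1 x -> x = 0.
Proof.
move=> rx; rewrite [x]e_decomposition big1 // => i _; exact: (b_rad rx).
Qed.

Lemma rad_b (N : lmodType Lam) (x : N) p : qpath p -> (0 < size p.2)%N -> rad 1 (b p *: x).
Proof.
case: p => v s; case/lastP: s => // s a p_q _.
by rewrite b_rcons // -scalerA; apply: rad_ar.
Qed.

(** * The idempotent [eps] *)

Lemma eps_mul_b q : qpath q -> eps * b q = if precyclic (endv q) then 0 else b q.
Proof.
move=> q_q; rewrite mulr_suml; case: ifP => [pq|/negbT npq].
  rewrite big1 // => i npi; rewrite e_mul_b //; case: eqP => // eqi.
  by rewrite -eqi pq in npi.
rewrite (bigD1 (endv q)) //= e_mul_b // eqxx big1 ?addr0 // => i /andP[_ iq].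
by rewrite e_mul_b // eq_sym (negPf iq).
Qed.

Lemma b_mul_eps p : qpath p -> b p * eps = if precyclic p.1 then 0 else b p.
Proof.
move=> p_q; rewrite mulr_sumr; case: ifP => [pp|/negbT npp].
  rewrite big1 // => i npi; rewrite b_mul_e //; case: eqP => // eqi.
  by rewrite eqi pp in npi.
rewrite (bigD1 p.1) //= b_mul_e // eqxx big1 ?addr0 // => i /andP[_ ip].
by rewrite b_mul_e // (negPf ip).
Qed.

(** Paths that start at a non-precyclic vertex also end at one. This is what makes [eps C] a
    submodule. *)
Lemma mul_eps x : eps * (x * eps) = x * eps.
Proof.
have eps_b p : qpath p -> eps * (b p * eps) = b p * eps.
  move=> p_q; rewrite b_mul_eps //; case: ifP => [_|/negbT npp]; first by rewrite mulr0.
  rewrite eps_mul_b //; case: ifP => // ep; case/negP: npp.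
  by case: p p_q ep => v s /andP[ws _]; apply: walk_precyclic.
have -> : x * eps = \sum_p co p x *: (b (pth p) * eps).
  by rewrite {1}[x]coE mulr_suml; under eq_bigr do rewrite -scalerAl.
by rewrite mulr_sumr; apply: eq_bigr => p _; rewrite -scalerAr eps_b.
Qed.

Lemma eps_idem : eps * eps = eps.
Proof. by have := mul_eps 1; rewrite mul1r. Qed.

(** * Extension of scalars from K to [Lam] *)

Section Tensor.
Variable N : lmodType Lam.

(* The coordinates, in the path basis of [Lam], of an element of [Lam (x)_K N]. *)
Definition tensor : Type := {ffun tpath -> N}.
HB.instance Definition _ := GRing.Zmodule.on tensor.

(** The matrix of left multiplication by [a] in the path basis acts on the coordinates. *)
Definition tensor_scale (a : Lam) (t : tensor) : tensor :=
  [ffun p => \sum_q (co p (a * b (pth q)))%:A *: t q].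

Let tensor_scalerA a c t : tensor_scale a (tensor_scale c t) = tensor_scale (a * c) t.
Proof.
apply/ffunP => p; rewrite !ffunE.
under eq_bigr => q _ do rewrite ffunE scaler_sumr.
rewrite exchange_big; apply: eq_bigr => r _ /=.
rewrite -mulrA {2}[c * _]coE mulr_sumr co_sumr alg_scaler_suml.
apply: eq_bigr => q _; rewrite -scalerAr coZ.
by rewrite scalerA mulr_algl scalerA mulrC.
Qed.

Let tensor_scale1r : left_id 1 tensor_scale.
Proof.
move=> t; apply/ffunP => p; rewrite !ffunE (bigD1 p) //= mul1r co_b eqxx !scale1r.
rewrite big1 ?addr0 // => q /negPf qp.
by rewrite mul1r co_b qp mulr0n !scale0r.
Qed.

Let tensor_scalerDr : right_distributive tensor_scale +%R.
Proof.
move=> a t u; apply/ffunP => p; rewrite !ffunE -big_split /=.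
by apply: eq_bigr => q _; rewrite ffunE scalerDr.
Qed.

Let tensor_scalerDl t : {morph tensor_scale^~ t : a c / a + c}.
Proof.
move=> a c; apply/ffunP => p; rewrite !ffunE -big_split /=.
by apply: eq_bigr => q _; rewrite mulrDl linearD !scalerDl.
Qed.

HB.instance Definition _ := GRing.Zmodule_isLmodule.Build Lam tensor
  tensor_scalerA tensor_scale1r tensor_scalerDr tensor_scalerDl.

Lemma tensor_scaleE a (t : tensor) p :
  (a *: t) p = \sum_q (co p (a * b (pth q)))%:A *: t q.
Proof. by rewrite ffunE. Qed.

Lemma tensor_algE k (t : tensor) p : (k%:A *: t) p = k%:A *: t p.
Proof.
rewrite tensor_scaleE (bigD1 p) //= mulr_algl coZ co_b eqxx.
rewrite mulr1 big1 ?addr0 // => q /negPf qp.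
by rewrite mulr_algl coZ co_b qp mulr0 !scale0r.
Qed.

(** The tensor [1 (x) x], spread over the trivial paths, whose sum is 1. *)
Definition pure (x : N) : tensor := [ffun p => (co p 1)%:A *: x].

Lemma scale_pureE a x p : (a *: pure x) p = (co p a)%:A *: x.
Proof.
have -> : co p a = \sum_q co q 1 * co p (a * b (pth q)).
  rewrite -{1}[a]mulr1 {1}[1]coE mulr_sumr co_sumr.
  by under eq_bigr do rewrite -scalerAr coZ.
rewrite tensor_scaleE alg_scaler_suml; apply: eq_bigr => q _.
by rewrite ffunE scalerA mulr_algl scalerA mulrC.
Qed.

Lemma pureD x y : pure (x + y) = pure x + pure y.
Proof. by apply/ffunP => p; rewrite !ffunE scalerDr. Qed.

Lemma pure_alg k x : pure (k%:A *: x) = k%:A *: pure x.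
Proof. by apply/ffunP => p; rewrite tensor_algE !ffunE alg_scalerC. Qed.

Lemma tensor_pure (t : tensor) : t = \sum_p b (pth p) *: pure (t p).
Proof.
apply/ffunP => p; rewrite sum_ffunE (bigD1 p) //= scale_pureE co_b eqxx !scale1r.
rewrite big1 ?addr0 // => q /negPf qp.
by rewrite scale_pureE co_b qp mulr0n !scale0r.
Qed.

(** Adjunction with restriction of scalars: [h] sends [a (x) x] to [a *: s x]. *)
Lemma tensor_universal (M : lmodType Lam) (s : {linear restrict N -> restrict M}) :
  exists h : {linear tensor -> M},
    forall t, h t = \sum_p b (pth p) *: (s (t p) : M).
Proof.
pose h (t : tensor) : M := \sum_p b (pth p) *: (s (t p) : M).
have h_lin : linear h.
  move=> a t u; rewrite /h scaler_sumr.
  transitivity (\sum_p (b (pth p) *: (s ((a *: t) p) : M) + b (pth p) *: (s (u p) : M))).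
    by apply: eq_bigr => p _; rewrite ffunE linearD scalerDr.
  rewrite big_split /=; congr (_ + _).
  have sE p : s ((a *: t) p) = \sum_q (co p (a * b (pth q)))%:A *: (s (t q) : M).
    rewrite tensor_scaleE (linear_sum s); apply: eq_bigr => q _.
    exact: (linearZ_LR s).
  under eq_bigr => p _ do rewrite sE scaler_sumr.
  rewrite exchange_big; apply: eq_bigr => q _ /=.
  rewrite scalerA [a * _]coE scaler_suml; apply: eq_bigr => p _.
  by rewrite alg_scalerC -alg_scalerAl -coE.
pose hL := GRing.isLinear.Build Lam tensor M _ h h_lin.
by exists (HB.pack h hL : {linear tensor -> M}).
Qed.

(** A K-linear section of [g] lifts the values of [f] on the tensors [1 (x) x], and the adjunction
    extends this lift. *)
Lemma tensor_projective : projective tensor.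
Proof.
move=> M M' g f g_surj; have [s gs] := surjective_section g_surj.
pose f1 (x : restrict N) : restrict M' := f (pure x).
have f1_lin : linear f1.
  move=> k x y; rewrite /f1.
  have -> : pure (k *: x + y) = k%:A *: pure x + pure y by rewrite -pure_alg -pureD.
  by rewrite linearP.
pose f1L := GRing.isLinear.Build K (restrict N) (restrict M') _ f1 f1_lin.
pose F1 : {linear restrict N -> restrict M'} := HB.pack f1 f1L.
have [h hE] := tensor_universal (s \o F1).
exists h => t; rewrite hE [in RHS](tensor_pure t) !linear_sum; apply: eq_bigr => p _.
by rewrite !linearZ /= gs.
Qed.

Lemma tensor_eval_exists :
  exists h : {linear tensor -> N},
    (forall t, h t = \sum_p b (pth p) *: t p) /\ forall x, h (pure x) = x.
Proof.
have [h hE] := tensor_universal idfun; exists h; split=> // x.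
rewrite hE -[RHS]scale1r [1 in RHS]coE scaler_suml.
by apply: eq_bigr => p _; rewrite ffunE alg_scalerC [RHS]alg_scalerAl.
Qed.
End Tensor.

(** * Projective dimension of modules fixed by [eps] *)

Lemma co_e_mul p i x : co p (e i * x) = if endv (pth p) == i then co p x else 0.
Proof.
rewrite {1}[x]coE mulr_sumr co_sumr (bigD1 p) //= -scalerAr coZ e_mul_b //.
rewrite big1 ?addr0 => [|q /negPf qp].
  by case: ifP => _; rewrite ?co_b ?eqxx ?mulr1 // -(scale0r 0) coZ mul0r mulr0.
rewrite -scalerAr coZ e_mul_b //; case: ifP => _; first by rewrite co_b qp mulr0.
by rewrite -(scale0r 0) coZ mul0r mulr0.
Qed.

Lemma co_mul_e p x i : co p (x * e i) = if i == (pth p).1 then co p x else 0.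
Proof.
rewrite {1}[x]coE mulr_suml co_sumr (bigD1 p) //= -scalerAl coZ b_mul_e //.
rewrite big1 ?addr0 => [|q /negPf qp].
  by case: ifP => _; rewrite ?co_b ?eqxx ?mulr1 // -(scale0r 0) coZ mul0r mulr0.
rewrite -scalerAl coZ b_mul_e //; case: ifP => _; first by rewrite co_b qp mulr0.
by rewrite -(scale0r 0) coZ mul0r mulr0.
Qed.

Lemma co_eps_mul p x : precyclic (endv (pth p)) -> co p (eps * x) = 0.
Proof.
move=> pp; rewrite mulr_suml big_mkcond co_sumr big1 //= => i _.
case: ifP => [npi|_]; last by rewrite -(scale0r 0) coZ mul0r.
by rewrite co_e_mul; case: eqP => // pi; rewrite -pi pp in npi.
Qed.

Lemma tensor_e (N : lmodType Lam) i (t : tensor N) p :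
  (e i *: t) p = if endv (pth p) == i then t p else 0.
Proof.
rewrite tensor_scaleE (bigD1 p) //= big1 ?addr0 => [|q /negPf qp].
  by rewrite co_e_mul co_b eqxx; case: ifP => _; [rewrite !scale1r | rewrite !scale0r].
by rewrite co_e_mul co_b qp; case: ifP => _; rewrite ?mulr0n !scale0r.
Qed.

(* The subspace [sum_i Lam e_i (x)_K e_i N] of the tensor product. *)
Lemma vertex_cover_exists (N : lmodType Lam) :
  exists (G : lmodType Lam) (i : {linear G -> tensor N}),
    [/\ projective G, injective i &
      forall t : tensor N, (forall p, e (pth p).1 *: t p = t p) <-> exists y, t = i y].
Proof.
pose S (t : tensor N) := forall p, e (pth p).1 *: t p = t p.
(* [r] projects onto the summand; it is linear because left multiplication preserves the starting
   vertex of a path. *)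
pose r (t : tensor N) : tensor N := [ffun p => e (pth p).1 *: t p].
have r_lin : linear r.
  move=> a t u; apply/ffunP => p; rewrite !(tensor_scaleE, ffunE) scalerDr scaler_sumr.
  congr (_ + _); apply: eq_bigr => q _; rewrite ffunE -alg_scalerC.
  have [-> //|neq] := eqVneq (pth p).1 (pth q).1.
  have -> : co p (a * b (pth q)) = 0; last by rewrite !scale0r !scaler0.
  have -> : a * b (pth q) = a * b (pth q) * e (pth q).1.
    by rewrite -mulrA b_mul_e // eqxx.
  by rewrite co_mul_e eq_sym (negPf neq).
pose rL := GRing.isLinear.Build Lam (tensor N) (tensor N) _ r r_lin.
pose r' : {linear tensor N -> tensor N} := HB.pack r rL.
have rS t : S (r t).
  by move=> p; rewrite ffunE scalerA e_mul_e eqxx.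
have Sr t : S t -> r t = t by move=> St; apply/ffunP => p; rewrite ffunE St.
have [|G [i [i_inj im_i]]] := @submodule_exists Lam (tensor N) S.
  have SE t : S t <-> r t = t by split=> [/Sr // | <-].
  split; first by apply/SE; exact: (linear0 r').
    by move=> t u /SE rt /SE ru; apply/SE; rewrite -[LHS]/(r' (t + u)) linearD /= rt ru.
  by move=> a t /SE rt; apply/SE; rewrite -[LHS]/(r' (a *: t)) linearZ_LR /= rt.
have [t|r1 r1E] := factor_through_injective (f := r') i_inj; first exact/im_i/rS.
exists G, i; split=> //; refine (projective_retract (i := i) (r := r1) _ _).
  by move=> y; apply: i_inj; rewrite r1E; apply: Sr; apply/im_i; exists y.
exact: tensor_projective.
Qed.

(** Induction on the largest rank in the support. In the kernel of [ev] on the vertex cover the rank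
    drops: nontrivial paths lower it, and at top rank the kernel condition kills the remaining
    coefficient. *)
Lemma acyclic_pd_le m (N : lmodType Lam) :
  (forall i (x : N), precyclic i || (m < reach src tgt i)%N -> e i *: x = 0) ->
  pd_le m N.
Proof.
elim: m N => [|m IHm] N N_supp.
  have N0 (x : N) : x = 0.
    by rewrite [x]e_decomposition big1 // => i _; rewrite N_supp ?reach_gt0 ?orbT.
  move=> M M' g f _; exists (\0 : {linear N -> M}) => x.
  by rewrite (N0 x) !linear0.
have [G [i [G_proj i_inj im_i]]] := vertex_cover_exists N.
have [ev [evE _]] := tensor_eval_exists N.
have [N0 [j [j_inj im_j]]] := submodule_exists (kernel_submodule (ev \o i)).
exists G, N0, j, (ev \o i); split=> //.
  move=> x.
  (* The preimage of [x] is the sum of the tensors [e_i (x) e_i x]. *)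
  have [|y yE] := (im_i ([ffun p => (co p 1)%:A *: (e (pth p).1 *: x)] : tensor N)).1.
    by move=> p; rewrite ffunE alg_scalerC; congr (_ *: _); rewrite scalerA e_mul_e eqxx.
  exists y; rewrite /= -yE evE -[RHS]scale1r [1 in RHS]coE scaler_suml.
  apply: eq_bigr => p _; rewrite ffunE alg_scalerC [RHS]alg_scalerAl; congr (_ *: _).
  by rewrite scalerA b_mul_e // eqxx.
apply: IHm => v y v_supp; apply: j_inj; apply: i_inj; rewrite !linear0 !linearZ_LR.
have : ev (i (j y)) = 0 by apply/im_j; exists y.
have : forall p, e (pth p).1 *: i (j y) p = i (j y) p by apply/im_i; exists (j y).
move: (i (j y)) => t t_supp ev_t.
(* Such a path starts outside the support of [N]; otherwise [v] would be non-precyclic of rank at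
   most [m]. *)
have t0 q : endv (pth q) = v -> (pth q).2 <> [::] -> t q = 0.
  case: (pth q) (t_supp q) (pth_qpath q) => s [//|a u] /= <- /andP[ws _] qv _; have {}ws : walk src tgt s (a :: u) := ws.
  have [|/norP[nps reach_s]] := boolP (precyclic s || (m.+1 < reach src tgt s)%N).
    exact: N_supp.
  move: v_supp (reach_walk nps ws) (contra (walk_precyclic ws) nps).
  rewrite qv => + lt_s npv; rewrite (negPf npv) /= => m_lt; move: reach_s; rewrite -leqNgt => s_le.
  by move: (leq_trans lt_s s_le); rewrite ltnS leqNgt m_lt.
apply/ffunP => p; rewrite [RHS]ffunE tensor_e; case: eqP => // pv.
have [pe|] := eqVneq (pth p).2 [::]; last by move/eqP; apply: t0.
have pE : pth p = (v, [::]) by move: pv pe; case: (pth p) => s u /= + u0; rewrite u0 => <-.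
(* In the [e v] component of [ev t = 0], only the trivial path at [v] contributes. *)
have := congr1 (fun x => e v *: x) ev_t; rewrite scaler0 evE scaler_sumr (bigD1 p) //=.
rewrite big1 ?addr0 => [|q qp].
  by rewrite pE scalerA e_mul_e eqxx; move: (t_supp p); rewrite pE => ->.
rewrite scalerA e_mul_b //; case: eqP => [qv|_]; last by rewrite scale0r.
rewrite t0 ?scaler0 // => qe; case/eqP: qp; apply: pth_inj; rewrite pE.
by move: qv qe; case: (pth q) => s u /= + u0; rewrite u0 => <-.
Qed.

Lemma eps_finite_pd (N : lmodType Lam) : (forall x : N, eps *: x = x) -> finite_pd N.
Proof.
move=> epsN; exists n; apply: acyclic_pd_le => i x; rewrite ltnNge reach_le orbF => pi.
by rewrite -(epsN x) scalerA (b_mul_eps (qpath_e i)) pi scale0r.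
Qed.

Lemma eps_submodule (P : lmodType Lam) (C : P -> Prop) : is_submodule C ->
  is_submodule (fun x => exists c, C c /\ x = eps *: c).
Proof.
move=> [C0 CD CZ]; split; first by exists 0; rewrite scaler0.
  by move=> _ _ [c [Cc ->]] [d [Cd ->]]; exists (c + d); rewrite scalerDr; split; first exact: CD.
move=> a _ [c [Cc ->]]; exists ((a * eps) *: c); split; first exact: CZ.
by rewrite !scalerA mul_eps.
Qed.

(** The kernel [eps C] is fixed by [eps], and [P] adds one step to its resolution. *)
Lemma quotient_finite_pd (P B : lmodType Lam) (C : P -> Prop) (q : {linear P -> B}) :
  projective P -> is_submodule C -> (forall y, exists x, q x = y) ->
  (forall x, q x = 0 <-> exists c, C c /\ x = eps *: c) -> finite_pd B.
Proof.
move=> P_proj C_sub q_surj q_ker.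
have [N [i [i_inj im_i]]] := submodule_exists (eps_submodule C_sub).
have [|k pdN] := @eps_finite_pd N.
  move=> x; apply: i_inj; rewrite linearZ_LR; have [|c [_ ->]] := (im_i (i x)).2.
    by exists x.
  by rewrite scalerA eps_idem.
exists k.+1, P, N, i, q; split=> // x.
by split=> [/q_ker/im_i | /im_i/q_ker].
Qed.

(** * Lifting along surjections whose kernel is killed by eps *)

(** A weak projectivity: lifting only along surjections whose kernel [eps] annihilates. *)
Definition lifts_eps (E : lmodType Lam) : Prop :=
  forall (U V : lmodType Lam) (g : {linear U -> V}) (f : {linear E -> V}),
    (forall y, exists x, g x = y) -> (forall u, g u = 0 -> eps *: u = 0) ->
    exists h : {linear E -> U}, forall x, g (h x) = f x.

(* A path [p] of length [L] annihilates [x] as soon as it annihilates its image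
   in [P]; in a lift of [x] to [Lam (x) S / eps (Lam (x) S)] the coefficient of
   [e_i] survives multiplication by [p], hence vanishes. *)
Lemma lifts_eps_top (E P S : lmodType Lam) (f : {linear E -> P}) (g : {linear E -> S}) x :
  lifts_eps E -> injective f -> (forall a (s : S), ar a *: s = 0) ->
  (forall s : S, eps *: s = 0) -> rad 1 (f x) -> g x = 0.
Proof.
move=> E_lift f_inj S_ar S_eps fx_rad.
have S_b p (s : S) : qpath p -> (0 < size p.2)%N -> b p *: s = 0.
  case: p => v w; case/lastP: w => // w a p_q _.
  by rewrite b_rcons // -scalerA S_ar.
rewrite [g x]e_decomposition big1 // => i _.
have [pi|npi] := boolP (precyclic i); last first.
  have -> : e i = e i * eps by rewrite b_mul_eps // (negPf npi).
  by rewrite -scalerA S_eps scaler0.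
have [w [ww wL pw]] := precyclic_walk L pi.
have p_q : qpath (i, w) by rewrite /Defs.qpath /= ww wL leqnn.
have [p pE] := pth_surj p_q.
have [|U [rho [rho_surj rho_ker]]] := @quotient_exists Lam (tensor S)
    (fun t => exists t', True /\ t = eps *: t').
  exact: (@eps_submodule (tensor S) (fun=> True)).
have [ev [evE ev_pure]] := tensor_eval_exists S.
have [|evU evUE] := factor_through_surjective (f := ev) rho_surj.
  by move=> _ /rho_ker[t' [_ ->]]; rewrite linearZ_LR S_eps.
have [||u uE] := E_lift U S evU g.
- by move=> s; exists (rho (pure s)); rewrite evUE.
- move=> y _; have [t <-] := rho_surj y; rewrite -linearZ_LR.
  by apply/rho_ker; exists t.
have [t tE] := rho_surj (u x).
have [t' [_ bt]] : exists t', True /\ b (i, w) *: t = eps *: t'.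
  apply/rho_ker; rewrite linearZ_LR tE -linearZ_LR.
  have -> : b (i, w) *: x = 0; last by rewrite linear0.
  by apply: f_inj; rewrite linear0 linearZ_LR (b_rad fx_rad) //= wL addn1.
(* Compare coefficients at [p] in [bt]: the right side vanishes since [p] ends at a precyclic
   vertex, and on the left only a trivial path can be followed by one of length [L]. *)
have t_i q : pth q = (i, [::]) -> t q = 0.
  move=> qE; have := congr1 (fun t : tensor S => t p) bt.
  rewrite /= !tensor_scaleE [RHS]big1 => [|r _]; last first.
    by rewrite co_eps_mul ?pE // !scale0r.
  rewrite (bigD1 q) //= qE b_mul_e // eqxx -pE co_b eqxx !scale1r big1 ?addr0 // => r rq.
  rewrite pE b_mul //=; case: ifP => [/andP[/eqP ri]|_]; last first.
    by rewrite -(scale0r 0) coZ mul0r !scale0r.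
  move=> sL; have /size0nil r0 : size (pth r).2 = 0%N.
    by move: sL; rewrite wL -[X in (_ <= X)%N]add0n leq_add2r leqn0 => /eqP.
  case/eqP: rq; apply: pth_inj; rewrite qE; move: ri r0.
  by case: (pth r) => v s /= + s0; rewrite s0 => <-.
rewrite -uE -tE evUE evE scaler_sumr big1 // => q _.
have [q0|q_gt0] := posnP (size (pth q).2); last by rewrite (S_b (pth q)) ?scaler0.
case qE: (pth q) q0 => [v s] /= /size0nil s0; rewrite s0 in qE *.
rewrite scalerA e_mul_e; case: eqP => [iv|_]; last by rewrite scale0r.
by rewrite t_i ?scaler0 // qE iv.
Qed.

(** In the quotient [S] of [Y] by [J Y] all arrows act by 0. A K-linear map that kills [J P] and
    agrees with [h] on [E] modulo [J Y] becomes [Lam]-linear after cutting by vertices, and lifts to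
    [Y] since [P] is projective. *)
Lemma extend_mod_rad (E P Y : lmodType Lam) (f : {linear E -> P}) (h : {linear E -> Y}) :
  projective P -> lifts_eps E -> injective f -> (forall y : Y, eps *: y = 0) ->
  exists k : {linear P -> Y}, forall x, rad 1 (h x - k (f x)).
Proof.
move=> P_proj E_lift f_inj Y_eps.
have [S [pi [pi_surj pi_ker]]] := quotient_exists (@rad_submodule Y 1).
have S_ar a (s : S) : ar a *: s = 0.
  by have [y <-] := pi_surj s; rewrite -linearZ_LR; apply/pi_ker/rad_ar.
have S_eps (s : S) : eps *: s = 0.
  by have [y <-] := pi_surj s; rewrite -linearZ_LR Y_eps linear0.
have pih0 x : rad 1 (f x) -> pi (h x) = 0.
  exact: (lifts_eps_top (pi \o h) E_lift f_inj S_ar S_eps).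
(* The case [x = 0] puts [J P] in the domain with value 0; [pih0] makes the values unique. *)
pose G (w : restrict P) (s : restrict S) := exists x, rad 1 ((w : P) - f x) /\ s = pi (h x).
have [||k0 k0G] := @linear_relation_extends K _ _ G.
- split; first by exists 0; rewrite !linear0 addr0; split=> //; apply: rad0.
  move=> c w s w' s' [x [wx ->]] [x' [wx' ->]]; exists (c%:A *: x + x').
  split; last by rewrite !linearP.
  rewrite linearP opprD addrACA -scalerBr.
  by apply: radD => //; apply: rad_scale.
- move=> _ [x [fx ->]]; apply: pih0.
  by rewrite -[f x]opprK -[- f x]sub0r; apply: radN.
have k0_rad w : rad 1 (w : P) -> k0 w = 0.
  by move=> rw; apply: k0G; exists 0; rewrite !linear0 addr0.
(* The vertex-diagonal part of [k0] commutes with the idempotents, and with arrows because both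
   sides vanish. *)
pose k (y : P) : S := \sum_i e i *: (k0 (e i *: y) : S).
have kD : {morph k : x y / x + y}.
  move=> x y; rewrite /k -big_split; apply: eq_bigr => i _ /=.
  have k0D : k0 (e i *: x + e i *: y) = k0 (e i *: x) + k0 (e i *: y) :> S.
    exact: (linearD k0).
  by rewrite scalerDr k0D scalerDr.
have kZ a y : k (a *: y) = a *: k y.
  move: a y; apply: Lam_ind => [i|a||c a IHa|a c IHa IHc|a c IHa IHc] y.
  - rewrite /k scaler_sumr; apply: eq_bigr => j _; rewrite !scalerA !e_mul_e eq_sym.
    by case: eqP => [->//|_]; rewrite !scale0r linear0 scaler0.
  - rewrite S_ar /k big1 // => i _; rewrite k0_rad ?scaler0 //.
    by apply: rad_scale; apply: rad_ar.
  - rewrite !scale0r; apply: (addrI (k 0)); by rewrite -kD !addr0.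
  - rewrite alg_scalerAl [RHS]alg_scalerAl -IHa /k scaler_sumr; apply: eq_bigr => i _.
    rewrite -[RHS]alg_scalerC [e i *: (c%:A *: _)]alg_scalerC; congr (_ *: _).
    exact: (linearZ_LR k0).
  - by rewrite !scalerDl kD IHa IHc.
  - by rewrite -!scalerA IHa IHc.
have k_lin : linear k by move=> a x y; rewrite kD kZ.
pose kL := GRing.isLinear.Build Lam P S _ k k_lin.
pose k1 : {linear P -> S} := HB.pack k kL.
have kf x : k1 (f x) = pi (h x).
  rewrite [RHS]e_decomposition; apply: eq_bigr => i _.
  rewrite (k0G _ (e i *: pi (h x))) ?scalerA ?e_mul_e ?eqxx //.
  by exists (e i *: x); split; [rewrite (linearZ_LR f) subrr; apply: rad0 | rewrite !linearZ_LR].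
have [k2 k2E] := P_proj Y S pi k1 pi_surj.
by exists k2 => x; apply/pi_ker; rewrite linearB /= k2E kf subrr.
Qed.

(** Successive approximation: an error with values in [J^m Y] is itself extended modulo the radical
    of [J^m Y]. After [L + 1] rounds it is 0. *)
Lemma extend_eps (E P Y : lmodType Lam) (f : {linear E -> P}) (h : {linear E -> Y}) :
  projective P -> lifts_eps E -> injective f -> (forall y : Y, eps *: y = 0) ->
  exists k : {linear P -> Y}, forall x, k (f x) = h x.
Proof.
move=> P_proj E_lift f_inj Y_eps.
suff [k kE] : exists k : {linear P -> Y}, forall x, rad L.+1 (h x - k (f x)).
  by exists k => x; apply/esym/subr0_eq/rad_nilpotent.
elim: L.+1 => [|m [k km]]; first by exists (\0 : {linear P -> Y}).
have [Y' [i [i_inj im_i]]] := submodule_exists (@rad_submodule Y m).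
have [|h' h'E] := factor_through_injective (f := h \- (k \o f)) i_inj.
  by move=> x; apply/im_i; exact: km.
have [y|k' k'E] := extend_mod_rad h' P_proj E_lift f_inj.
  by apply: i_inj; rewrite linearZ_LR Y_eps linear0.
exists (k \+ (i \o k')) => x; have := rad_linear_shift (f := i) _ (k'E x).
rewrite linearB h'E /= opprD addrA; apply.
by move=> y; apply/im_i; exists y.
Qed.

(** Lift [f \o p] to [h] on [P]. On the syzygy [E] it lands in the kernel of [g]; extending this
    restriction to [P] and subtracting it from [h] gives a map that descends to [X]. *)
Lemma finite_pd_lifts_eps (X : lmodType Lam) : finite_pd X -> lifts_eps X.
Proof.
case=> k; elim: k X => [|k IHk] X /=.
  by move=> X_proj U V g f g_surj _; apply: X_proj.
case=> P [E [i [p [P_proj i_inj p_surj p_ker /IHk E_lift]]]] U V g f g_surj g_ker.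
have [h hE] := P_proj U V g (f \o p) g_surj.
have [Y [j [j_inj im_j]]] := submodule_exists (kernel_submodule g).
have pi0 y : p (i y) = 0 by apply/p_ker; exists y.
have [y|h' h'E] := factor_through_injective (f := h \o i) j_inj.
  by apply/im_j; rewrite hE /= pi0 linear0.
have [y|k' k'E] := extend_eps h' P_proj E_lift i_inj.
  by apply: j_inj; rewrite linearZ_LR linear0; apply: g_ker; apply/im_j; exists y.
have [x|h1 h1E] := factor_through_surjective (f := h \- (j \o k')) p_surj.
  by case/p_ker=> y ->; rewrite /= k'E h'E subrr.
exists h1 => x; have [y <-] := p_surj x; rewrite h1E linearB /= hE.
suff -> : g (j (k' y)) = 0 by rewrite subr0.
by apply/im_j; exists (k' y).
Qed.

Lemma quotient_right_approx (P M B : lmodType Lam) (C : P -> Prop)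
    (pi : {linear P -> M}) (q : {linear P -> B}) (phi : {linear B -> M}) :
  projective P -> is_submodule C ->
  (forall y, exists x, pi x = y) -> (forall x, pi x = 0 <-> C x) ->
  (forall y, exists x, q x = y) ->
  (forall x, q x = 0 <-> exists c, C c /\ x = eps *: c) ->
  (forall x, phi (q x) = pi x) ->
  right_approx (@finite_pd Lam) phi.
Proof.
move=> P_proj C_sub pi_surj pi_ker q_surj q_ker phiE.
split; first exact: quotient_finite_pd P_proj C_sub q_surj q_ker.
move=> X f /finite_pd_lifts_eps X_lift; apply: X_lift.
  by move=> y; have [x <-] := pi_surj y; exists (q x).
(* The kernel of [phi] is the image of [C] under [q], and [q] kills [eps C]. *)
move=> u; have [x <-] := q_surj u; rewrite phiE -linearZ_LR => /pi_ker Cx.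
by apply/q_ker; exists x.
Qed.

(** Every [M] is presented by [ev], with projective source [tensor M]. *)
Lemma finite_pd_contravariantly_finite : contravariantly_finite (@finite_pd Lam).
Proof.
move=> M; have [ev [_ ev_pure]] := tensor_eval_exists M.
have C_sub := kernel_submodule ev.
have [B [q [q_surj q_ker]]] := quotient_exists (eps_submodule C_sub).
have [|phi phiE] := factor_through_surjective (f := ev) q_surj.
  by move=> _ /q_ker[c [ev_c ->]]; rewrite linearZ_LR ev_c scaler0.
exists B, phi; apply: (quotient_right_approx _ C_sub _ _ q_surj q_ker phiE) => //.
  exact: tensor_projective.
by move=> x; exists (pure x).
Qed.

(** * The Jacobson radical and minimality *)

Lemma jacobson_co_e j p i : jacobson j -> pth p = (i, [::]) -> co p j = 0.
Proof.
move=> j_jac pE; apply/eqP; apply: contraT => c_neq0.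
(* With this factor the left invertible [x] has coefficient 0 at [e i], which is absurd since that
   coefficient is multiplicative. *)
have [z] := j_jac ((co p j)^-1 *: e i).
set x := 1 - _ => zx.
(* A trivial path factors only through itself. *)
have co_mul u : co p (z * u) = co p z * co p u.
  rewrite {1}[u]coE mulr_sumr co_sumr (bigD1 p) //= big1 ?addr0 => [|q qp].
    by rewrite -scalerAr coZ pE co_mul_e pE eqxx mulrC.
  rewrite -scalerAr coZ {1}[z]coE mulr_suml co_sumr big1 ?mulr0 // => r _.
  rewrite -scalerAl coZ b_mul //; case: ifP => [/andP[/eqP qr sL]|_]; last first.
    by rewrite -(scale0r 0) coZ mul0r mulr0.
  rewrite co_b_neq ?mulr0 //.
    rewrite /Defs.qpath walk_cat size_cat sL.
    case/andP: (pth_qpath q) => -> _; rewrite -[endv _]/(endv (pth q)) qr.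
    by case/andP: (pth_qpath r) => ->.
  apply: contra qp; rewrite pE => /eqP qr0; apply/eqP/pth_inj; rewrite pE.
  by move: qr0; case: (pth q) => v [|a s] //= [-> _].
have co1 : co p 1 = 1.
  have : co p (1 * e i) = 1 by rewrite mul1r -pE co_b eqxx.
  by rewrite co_mul_e pE eqxx.
have x0 : co p x = 0.
  rewrite /x -scalerAl -scaleN1r linearD /= !coZ co_e_mul pE [endv _ == i]eqxx.
  by rewrite co1 mulVf // mulr1 subrr.
have /eqP := congr1 (co p) zx.
by rewrite co_mul x0 mulr0 co1 eq_sym oner_eq0.
Qed.

(** Trivial paths have coefficient 0 in each [j i], and all other paths end with an arrow. *)
Lemma in_radP_rad (P : lmodType Lam) (x : P) : in_radP x -> rad 1 x.
Proof.
case=> m [j [y [j_jac ->]]]; have [r0 rD _] := @rad_submodule P 1.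
apply: (big_ind (@rad P 1)) => // i _.
rewrite [j i]coE scaler_suml; apply: (big_ind (@rad P 1)) => // p _.
rewrite alg_scalerAl; have [p0|p_gt0] := posnP (size (pth p).2); last first.
  by apply: rad_alg; apply: rad_b.
rewrite (@jacobson_co_e _ p (pth p).1) ?scale0r ?scale0r //.
by move: p0; case: (pth p) => v s /= /size0nil ->.
Qed.

(** The difference [g - id] raises the radical degree, hence is nilpotent. A kernel element [z]
    equals [-(g z - z)], so it lies in every [J^m B]. *)
Lemma id_add_rad_bijective (B : lmodType Lam) (g : {linear B -> B}) :
  (forall x, rad 1 (g x - x)) -> bijective g.
Proof.
move=> g_rad; have d_rad m x : rad m x -> rad m.+1 (g x - x).
  by rewrite -addn1; apply: (rad_linear_shift (f := g \- idfun) g_rad).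
have g_inj : injective g.
  move=> x y gxy; apply/subr0_eq/rad_nilpotent.
  have gz : g (x - y) = 0 by rewrite linearB gxy subrr.
  elim: L.+1 => // m /d_rad; rewrite gz sub0r => rz.
  by rewrite -[x - y]opprK; apply: radN.
have g_surj y : exists x, g x = y.
  suff [x gx] : exists x, rad L.+1 (g x - y) by exists x; apply/subr0_eq/rad_nilpotent.
  elim: L.+1 => [|m [x /d_rad rx]]; first by exists 0.
  (* Subtracting the error [z] from [x] leaves the error [-(g z - z)], one degree deeper. *)
  exists (x - (g x - y)); set z := g x - y in rx *.
  have -> : g (x - z) - y = - (g z - z) by rewrite linearB opprB addrAC -/z addrC.
  exact: radN.
have [f gf] := choice g_surj.
by exists f => // x; apply: g_inj; rewrite gf.
Qed.
End TruncatedPathAlgebra.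

Theorem theorem4p2
  (K : fieldType) (n : nat) (A : finType) (src tgt : A -> 'I_n) (L : nat)
  (HL : (1 <= L)%N)
  (Lam : algType K) (b : 'I_n * seq A -> Lam)
  (HLam : is_truncated_path_algebra src tgt L b)
  (P : lmodType Lam) (HP : projective P)
  (C : P -> Prop) (HC : is_submodule C) (HCJ : forall x, C x -> in_radP x)
  (M : lmodType Lam) (pi : {linear P -> M})
  (Hpi_surj : forall y, exists x, pi x = y)
  (Hpi_ker : forall x, pi x = 0 <-> C x)
  (B : lmodType Lam) (q : {linear P -> B})
  (Hq_surj : forall y, exists x, q x = y)
  (Hq_ker : forall x, q x = 0 <-> exists c, C c /\ x = eps_np src tgt b *: c)
  (phi : {linear B -> M}) (Hphi : forall x, phi (q x) = pi x) :
  minimal_right_approx (@finite_pd Lam) phi /\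
  contravariantly_finite (@finite_pd Lam).
Proof.
split; last exact: (finite_pd_contravariantly_finite HL HLam).
split.
  exact: (quotient_right_approx HL HLam HP HC Hpi_surj Hpi_ker Hq_surj Hq_ker Hphi).
move=> g phi_g; apply: (id_add_rad_bijective HL HLam) => x.
(* [phi] kills [g x - x], so its preimage [y] lies in [C], hence in [J P], and [q] maps it into
   [J B]. *)
have [y yE] := Hq_surj (g x - x); rewrite -yE; apply: rad_linear.
apply: (in_radP_rad HL HLam); apply: HCJ; apply/Hpi_ker.
by rewrite -Hphi yE linearB phi_g subrr.
Qed.
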